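(* Let $\beta>1$ be a Sturmian number such that the set of letters occurring in $d_\beta(1)$ is $\{a,b\}$ with $0\leq a<b=\lfloor\beta\rfloor$. Then the closure of $\{T_\beta^n1\}_{n\geq0}$ has Lebesgue measure zero.
   Context: For $\beta>1$, $T_\beta(x)=\beta x\bmod1$ on $[0,1]$ and $d_\beta(x)=(x_i)_{i\ge1}$ with $x_i=\lfloor\beta T_\beta^{i-1}(x)\rfloor$. $\beta$ is a Sturmian number if $d_\beta(1)$ is a Sturmian word (an infinite word with exactly $n+1$ distinct factors of length $n$ for each $n\ge0$) over a binary alphabet $\{a,b\}$ with $0\le a<b=\lfloor\beta\rfloor$. *)

(* Defs.v *)
From HB Require Import structures.
From mathcomp Require Import all_boot all_order all_algebra.
From mathcomp Require Import all_classical all_reals all_analysis.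

Set Implicit Arguments.
Unset Strict Implicit.
Unset Printing Implicit Defensive.

Import Order.TTheory GRing.Theory Num.Theory.
Import numFieldNormedType.Exports.

Local Open Scope classical_set_scope.
Local Open Scope ring_scope.

Definition beta_map (R : realType) (beta x : R) : R := beta * x - (Num.floor (beta * x))%:~R.

(* Words are indexed from 0, so [beta_expansion beta x i] is the digit x_(i+1). *)
Definition beta_expansion (R : realType) (beta x : R) : nat -> int :=
  fun i => Num.floor (beta * iter i (beta_map beta) x).

Definition factors (T : Type) (w : nat -> T) (n : nat) : set (seq T) :=
  [set mkseq (fun k => w (i + k)%N) n | i in [set: nat]].

Definition sturmian_word (T : Type) (w : nat -> T) : Prop :=
  forall n : nat, (factors w n #= `I_n.+1)%card.

Definition sturmian_number (R : realType) (beta : R) : Prop :=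
  [/\ 1 < beta,
      sturmian_word (beta_expansion beta 1)
    & exists a b : int,
        [/\ 0 <= a, a < b, b = Num.floor beta
          & range (beta_expansion beta 1) `<=` [set a; b]]].

(* Main.v *)
Require Import Defs.
From HB Require Import structures.
From mathcomp Require Import all_boot all_order all_algebra.
From mathcomp Require Import all_classical all_reals all_analysis.
From mathcomp Require Import ring lra.

Set Implicit Arguments.
Unset Strict Implicit.
Unset Printing Implicit Defensive.

Import Order.TTheory GRing.Theory Num.Theory.
Import numFieldNormedType.Exports.

Local Open Scope classical_set_scope.
Local Open Scope ring_scope.

(** A point of the orbit of 1 is determined up to [beta ^- n] by its first [n]
    digits, and these form a factor of length [n] of the expansion of 1. A
    Sturmian word has only [n + 1] such factors, so the orbit, and with it its
    closure, is covered by [n + 1] closed intervals of length [beta ^- n]; the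
    total length [(n + 1) / beta ^ n] tends to 0. *)

Lemma bernoulli_inequality (R : realDomainType) (h : R) (n : nat) :
  0 <= h -> 1 + n%:R * h <= (1 + h) ^+ n.
Proof.
move=> h0; elim: n => [|n IHn]; first by rewrite mul0r addr0 expr0.
rewrite exprS -natr1; apply: (@le_trans _ _ ((1 + h) * (1 + n%:R * h))).
  have : 0 <= n%:R * (h * h) by rewrite !mulr_ge0.
  by nra.
by rewrite ler_wpM2l // addr_ge0.
Qed.

(** Bernoulli gives only linear growth of [beta ^+ m], too weak against the numerator. Squaring it,
    with exponent [m + m], gives quadratic growth and a quotient of order [1 / m]. *)
Lemma natrS_div_expr_small (R : archiRealFieldType) (beta e : R) :
  1 < beta -> 0 < e -> exists n, n.+1%:R / beta ^+ n <= e.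
Proof.
move=> beta1 e0.
(* This [c] makes [c * (m + 1) = c + m * c] at most the Bernoulli bound [1 + m * (beta - 1)], term
   by term. *)
pose c := Num.min 1 (beta - 1).
have c0 : 0 < c by rewrite lt_min ltr01 subr_gt0.
have c1 : c <= 1 by rewrite ge_min lexx.
have cb : c <= beta - 1 by rewrite ge_min lexx orbT.
have growth m : c * m.+1%:R <= beta ^+ m.
  have : 1 + m%:R * (beta - 1) <= beta ^+ m.
    have := @bernoulli_inequality R (beta - 1) m.
    by rewrite (_ : 1 + (beta - 1) = beta); [apply; lra | ring].
  apply: le_trans; rewrite -natr1 mulrDr mulr1 addrC lerD// mulrC.
  by rewrite ler_wpM2l.
have ce0 : 0 < c ^+ 2 * e by rewrite mulr_gt0 // exprn_gt0.
have k0 : 0 <= 2 / (c ^+ 2 * e) by rewrite divr_ge0 // ltW.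
(* With [n = m + m] the goal follows from [2 * (m + 1) <= e * (c * (m + 1)) ^+ 2], that is, from
   [2 / (c ^+ 2 * e) <= m + 1]. *)
have := archi_boundP k0; set m := Num.bound _ => mP.
exists (m + m)%N.
have bm0 : 0 < beta ^+ m by rewrite exprn_gt0 // (lt_trans ltr01).
rewrite exprD ler_pdivrMr ?mulr_gt0 //.
have m0 : 0 < m.+1%:R :> R by rewrite ltr0n.
apply: (@le_trans _ _ (2 * m.+1%:R)).
  by rewrite -natrM ler_nat mul2n -addnn addnS ltnS addSn leqnSn.
apply: (@le_trans _ _ (e * (c * m.+1%:R * (c * m.+1%:R)))); last first.
  by rewrite ler_wpM2l ?(ltW e0) // ler_pM ?growth // mulr_ge0 // ltW.
have : 2 <= m.+1%:R * (c ^+ 2 * e).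
  by rewrite -ler_pdivrMr // (le_trans (ltW mP)) // ler_nat.
rewrite -(ler_pM2r m0) => /le_trans; apply.
by rewrite le_eqVlt; apply/orP; left; apply/eqP; ring.
Qed.

Lemma iter_beta_map_itv (R : realType) (beta x : R) (n : nat) :
  0 <= x <= 1 -> 0 <= iter n (beta_map beta) x <= 1.
Proof.
move=> x01; case: n => [//|n]; rewrite iterS /beta_map.
have := floor_itv (beta * iter n (beta_map beta) x).
by rewrite intrD => /andP[? ?]; apply/andP; split; lra.
Qed.

Definition beta_value (R : realType) (beta : R) (s : seq int) : R :=
  \sum_(k < size s) (s`_k)%:~R / beta ^+ k.+1.

(** Each [y] equals its first digit plus [beta_map beta y], divided by [beta]; this is unrolled [n]
    times. *)
Lemma beta_value_expansion (R : realType) (beta x : R) (n : nat) :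
  beta != 0 ->
  x = beta_value beta (mkseq (beta_expansion beta x) n)
      + iter n (beta_map beta) x / beta ^+ n.
Proof.
move=> beta0; rewrite /beta_value size_mkseq.
under eq_bigr => k _ do rewrite nth_mkseq //.
elim: n => [|n IHn]; first by rewrite big_ord0 add0r expr0 divr1.
rewrite {1}IHn big_ord_recr /= -addrA; congr (_ + _).
rewrite {2}/beta_map -/(beta_expansion beta x n) exprS; field.
by rewrite expf_neq0.
Qed.

Lemma beta_expansion_iter (R : realType) (beta x : R) (i k : nat) :
  beta_expansion beta (iter i (beta_map beta) x) k
  = beta_expansion beta x (i + k).
Proof. by rewrite /beta_expansion -iterD addnC. Qed.

Lemma orbit_beta_map_cover (R : realType) (beta x : R) (n : nat) :
  0 < beta -> 0 <= x <= 1 ->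
  [set iter i (beta_map beta) x | i in [set: nat]] `<=`
  \bigcup_(v in beta_value beta @` factors (beta_expansion beta x) n)
    `[v, v + beta ^- n]%classic.
Proof.
move=> beta0 x01 _ [i _ <-].
set s := mkseq (fun k => beta_expansion beta x (i + k)%N) n.
exists (beta_value beta s); first by exists s => //; exists i.
(* The factor at position [i] consists of the first [n] digits of the [i]-th orbit point, so that
   point differs from [beta_value beta s] by a later orbit point, in [[0, 1]], over [beta ^+ n]. *)
have sE : s = mkseq (beta_expansion beta (iter i (beta_map beta) x)) n.
  by apply: eq_mkseq => k; rewrite beta_expansion_iter.
rewrite /= in_itv /= (@beta_value_expansion _ beta (iter i _ x) n) ?gt_eqF //.
rewrite -sE -iterD.
have /andP[y0 y1] := @iter_beta_map_itv _ beta x (n + i) x01.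
have bn0 : 0 < beta ^- n by rewrite invr_gt0 exprn_gt0.
rewrite lerDl lerD2l mulr_ge0 ?(ltW bn0) //=.
by rewrite ler_piMl // ltW.
Qed.

(** A finite union of closed intervals is closed, so it contains the closure of [A] as well;
    subadditivity then bounds the measure. *)
Lemma lebesgue_measure_closure_cover (R : realType) (A V : set R) (l : R)
    (n : nat) :
  0 <= l -> (V #<= `I_n)%card -> A `<=` \bigcup_(v in V) `[v, v + l]%classic ->
  (lebesgue_measure (closure A) <= (n%:R * l)%:E)%E.
Proof.
(* The values of [g] on [I_n] cover [V]; repetitions or values outside [V] only add intervals. *)
move=> l0 /pcard_surjP[g gV] AV.
pose I i := `[g i, g i + l]%classic : set R.
have muI i : (lebesgue_measure (I i) <= l%:E)%E.
  rewrite lebesgue_measure_itv /= lte_fin.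
  by case: ifP => _; rewrite -?EFinB lee_fin // addrC addKr.
have clU : closed (\big[setU/set0]_(i < n) I i).
  by apply: closed_bigsetU => i _; exact: interval_closed.
have AU : closure A `<=` \big[setU/set0]_(i < n) I i.
  rewrite [X in _ `<=` X](iffLR (closure_id _) clU).
  apply: closureS => x /AV[v /gV[i /= lt_in <-] xI].
  by rewrite -bigcup_mkord; exists i.
have mU := measurable_realfun.closed_measurable clU.
apply: le_trans (le_measure lebesgue_measure _ _ AU) _; rewrite ?inE //.
  by apply: measurable_realfun.closed_measurable; exact: closed_closure.
apply: le_trans (Boole_inequality lebesgue_measure _) _ => [i _|].
  exact: measurable_itv.
apply: (@le_trans _ _ (\sum_(i < n) l%:E)%E).
  by apply: lee_sum => i _; exact: muI.
by rewrite sumEFin sumr_const card_ord mulr_natl.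
Qed.

Theorem theorem10 (R : realType) (beta : R) (a b : int)
  (beta_gt1 : 1 < beta)
  (beta_sturmian : sturmian_number beta)
  (letters : range (beta_expansion beta 1) = [set a; b])
  (a_ge0 : 0 <= a) (a_lt_b : a < b) (b_floor : b = Num.floor beta) :
  lebesgue_measure
    (closure [set iter n (beta_map beta) 1 | n in [set: nat]]) = 0%E.
Proof.
have [_ sturm _] := beta_sturmian.
have beta0 : 0 < beta := lt_trans ltr01 beta_gt1.
apply/eqP; rewrite eq_le measure_ge0 andbT.
apply/lee_addgt0Pr => e e0; rewrite add0e.
have [n le_e] := natrS_div_expr_small beta_gt1 e0.
have cardV : (beta_value beta @` factors (beta_expansion beta 1%R) n
              #<= `I_n.+1)%card.
  (* Distinct factors may share a value, so the image has at most as many points as there are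
     factors, [n + 1]. *)
  by apply: card_le_trans (card_image_le _ _) _; have /card_eqPle[] := sturm n.
have x01 : 0 <= (1 : R) <= 1 by rewrite ler01 lexx.
apply: le_trans
  (lebesgue_measure_closure_cover _ cardV (orbit_beta_map_cover n beta0 x01)) _.
  by rewrite invr_ge0 exprn_ge0 // ltW.
by rewrite lee_fin.
Qed.
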